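(* Let $k$ and $m$ be non-negative integers with $m \le k+1$, and let $G$ be a connected $K_{1,4}$-free graph of order $n$. If $\sigma_{m+2}(G) \ge n-k$, then $G$ has a spanning tree $T$ with $|L(T)| + |B(T)| \le m+k+2$.
   Context: All graphs are finite, simple (no loops or multiple edges). For a tree $T$, a leaf is a vertex of degree one in $T$ and a branch vertex is a vertex of degree at least three in $T$; $L(T)$ and $B(T)$ denote the sets of leaves and of branch vertices of $T$. A graph is $K_{1,4}$-free if it contains no induced subgraph isomorphic to the star $K_{1,4}$. $\alpha(G)$ is the independence number of $G$. For a positive integer $p$, $\sigma_p(G)=+\infty$ if $\alpha(G)<p$, and otherwise $\sigma_p(G)=\min\{\sum_{i=1}^p d_G(v_i) : \{v_1,\dots,v_p\}$ is an independent set of $G\}$, where $d_G(v)$ is the degree of $v$ in $G$. *)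

(* Defs.v *)
From mathcomp Require Import all_boot.
Set Implicit Arguments. Unset Strict Implicit. Unset Printing Implicit Defensive.

Section Graphs.
Variable T : finType.

Definition simple_graph (e : rel T) : Prop := symmetric e /\ irreflexive e.

Definition connected_graph (e : rel T) : Prop := forall x y : T, connect e x y.

Definition deg (e : rel T) (v : T) : nat := #|[set y | e v y]|.

Definition independent (e : rel T) (S : {set T}) : Prop :=
  forall x y, x \in S -> y \in S -> ~~ e x y.

Definition K14_free (e : rel T) : Prop :=
  ~ exists (c : T) (L : {set T}),
      [/\ #|L| = 4, {in L, forall y, e c y} & independent e L].

(* sigma_p(G) >= b, unfolded:  sigma_p = +oo if alpha < p (then the
   inequality holds), otherwise the min over independent p-sets of the
   degree sum. *)
Definition sigma_ge (e : rel T) (p b : nat) : Prop :=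
  forall S : {set T}, independent e S -> #|S| = p -> b <= \sum_(v in S) deg e v.

(* t is a spanning tree of e: a symmetric subgraph on all vertices that is
   connected and has exactly #|T| - 1 edges (each edge counted by its two
   orientations). *)
Definition spanning_tree (e t : rel T) : Prop :=
  [/\ symmetric t, subrel t e, connected_graph t &
      #|[set p : T * T | t p.1 p.2]| = 2 * (#|T| - 1)].

Definition leaves (t : rel T) : {set T} := [set v | deg t v == 1].
Definition branches (t : rel T) : {set T} := [set v | 3 <= deg t v].

End Graphs.

(* Main.v *)
Require Import Defs.
From mathcomp Require Import all_boot.
From mathcomp Require Import zify.
Set Implicit Arguments. Unset Strict Implicit. Unset Printing Implicit Defensive.

(* Let [t] be a spanning tree with the fewest leaves, and suppose it has at
   least three.  It suffices to show that the [e]-degrees of its leaves plus its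
   number of branch vertices total at most [#|T|]: if there were too many leaves
   and branch vertices, then (branch vertices being fewer than leaves by at least
   two, and [m <= k + 1]) [t] would have [m + 2] leaves, and these are independent
   with degree sum below [#|T| - k].

   For an adjacency [e y v] of a leaf [y], mark the dart [v -> u] of [t] where [u]
   is the neighbour of [v] towards [y].  Edge exchanges which would lower the
   number of leaves, together with [K14_free], show that different adjacencies
   mark different darts, that no edge is marked in both directions, that the head
   of a marked dart is not a branch vertex, and that two branch vertices are never
   joined by a path of marked edges.  So the marked edges form a forest with at
   least [#|branches t|] components, hence at most [#|T| - #|branches t|] edges. *)

Ltac deg_lia :=
  clear; repeat match goal with |- context [deg ?t ?v] => move: (deg t v) => ? end;
  lia.

(** * Adding, deleting and exchanging edges: degrees and connectivity *)

Section EdgeOperations.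
Variable T : finType.
Implicit Types (t f g r : rel T) (a b c d u v w x y z : T) (B : {set T}).

Definition edge_of a b : rel T :=
  [rel x y | (x == a) && (y == b) || (x == b) && (y == a)].
Definition add_edge t a b : rel T := [rel x y | t x y || edge_of a b x y].
Definition del_edge t c d : rel T := [rel x y | t x y && ~~ edge_of c d x y].
Definition swap t a b c d : rel T := add_edge (del_edge t c d) a b.
Definition off t v : rel T := [rel x y | [&& t x y, x != v & y != v]].

(* For an edge [v u] of a tree, [behind t v u] is the set of vertices whose
   path from [v] starts with [u]. *)
Definition behind t v u x := connect (off t v) u x.

Lemma edge_ofC a b x y : edge_of a b y x = edge_of a b x y.
Proof. by rewrite /edge_of /=; do !case: (_ == _). Qed.

Lemma add_edge_sym t a b : symmetric t -> symmetric (add_edge t a b).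
Proof. by move=> ts x y; rewrite /add_edge /= ts (edge_ofC a b x y). Qed.

Lemma del_edge_sym t a b : symmetric t -> symmetric (del_edge t a b).
Proof. by move=> ts x y; rewrite /del_edge /= ts (edge_ofC a b x y). Qed.

Lemma swap_sym t a b c d : symmetric t -> symmetric (swap t a b c d).
Proof. by move=> ts; apply/add_edge_sym/del_edge_sym. Qed.

Lemma off_sym t v : symmetric t -> symmetric (off t v).
Proof. by move=> ts x y; rewrite /off /= ts [(y != v) && _]andbC. Qed.

Lemma behind_neq t v u x : behind t v u x -> u != v -> x != v.
Proof.
move=> /connectP[p]; elim: p u => [|z p IH] u /=; first by move=> _ -> .
by case/andP=> /and3P[_ _ zv] /IH h /h /(_ zv).
Qed.

(** Sharpens [connect_sub]: a step has to transfer only if it starts at a vertex reachable from [u].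
    [behind_step] needs this, since avoiding its new vertex is known only there. *)
Lemma connect_reachable r r' u x :
  (forall z z', connect r u z -> r z z' -> r' z z') ->
  connect r u x -> connect r' u x.
Proof.
move=> h /connectP[p]; elim/last_ind: p x => [|p z IH] x /=.
  by move=> _ ->.
rewrite rcons_path last_rcons => /andP[pp rz] ->.
apply: connect_trans (IH _ pp erefl) _; apply/connect1/h => //.
by apply/connectP; exists p.
Qed.

Lemma connect_add_edge f a b x y : connect (add_edge f a b) x y ->
  [\/ connect f x y, connect f x a /\ connect f b y
    | connect f x b /\ connect f a y].
Proof.
case/connectP=> p; elim: p x => [|z p IH] x /=.
  by move=> _ ->; constructor 1.
case/andP=> /orP[fxz|exz] pp ly.
  have xz := connect1 fxz.
  case: (IH _ pp ly) => [h|[h1 h2]|[h1 h2]].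
  - by constructor 1; apply: connect_trans h.
  - by constructor 2; split=> //; apply: connect_trans h1.
  - by constructor 3; split=> //; apply: connect_trans h1.
case/orP: exz => /andP[/eqP xa /eqP zb]; subst x z.
  by case: (IH _ pp ly) => [h|[_ h]|[_ h]];
    [constructor 2 | constructor 2 | constructor 1].
by case: (IH _ pp ly) => [h|[_ h]|[_ h]];
    [constructor 3 | constructor 1 | constructor 3].
Qed.

Lemma deg_add_edge t a b v : symmetric t -> a != b -> ~~ t a b ->
  deg (add_edge t a b) v = deg t v + ((v == a) + (v == b)).
Proof.
move=> ts ab tab; rewrite /deg.
case: (eqVneq v a) => [->|va].
  rewrite (negPf ab) addn0.
  have -> : [set y | add_edge t a b a y] = b |: [set y | t a y].
    by apply/setP=> y; rewrite !inE /add_edge /edge_of /= eqxx (negPf ab) /= orbF orbC.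
  by rewrite cardsU1 inE tab addnC.
case: (eqVneq v b) => [->|vb].
  have -> : [set y | add_edge t a b b y] = a |: [set y | t b y].
    by apply/setP=> y; rewrite !inE /add_edge /edge_of /= eqxx eq_sym (negPf ab) /= orbC.
  by rewrite cardsU1 inE ts tab addnC.
rewrite addn0; congr #|pred_of_set _|; apply/setP=> y.
by rewrite !inE /add_edge /edge_of /= (negPf va) (negPf vb) orbF.
Qed.

Lemma del_edgeK t c d : symmetric t -> t c d ->
  add_edge (del_edge t c d) c d =2 t.
Proof.
move=> ts tcd x y; rewrite /add_edge /del_edge /=.
case: (boolP (edge_of c d x y)) => [|_]; last by rewrite andbT orbF.
by rewrite orbT => /orP[]/andP[/eqP-> /eqP->]; rewrite // ts.
Qed.

Lemma eq_deg t t' v : t =2 t' -> deg t v = deg t' v.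
Proof. by move=> h; apply: eq_card => y; rewrite !inE h. Qed.

Lemma deg_del_edge t c d v : symmetric t -> t c d -> c != d ->
  deg t v = deg (del_edge t c d) v + ((v == c) + (v == d)).
Proof.
move=> ts tcd cd; rewrite -deg_add_edge //; last 2 first.
- exact: del_edge_sym.
- by rewrite /del_edge /edge_of /= !eqxx andbF.
by apply: eq_deg => x y; rewrite del_edgeK.
Qed.

(** The lost edge is counted on the left to avoid truncated subtraction. The indicators also stay
    correct when the two exchanged edges share an endpoint. *)
Lemma deg_swap t a b c d v : symmetric t -> t c d -> c != d -> a != b ->
  ~~ del_edge t c d a b ->
  deg (swap t a b c d) v + ((v == c) + (v == d)) =
    deg t v + ((v == a) + (v == b)).
Proof.
move=> ts tcd cd ab nab.
rewrite deg_add_edge //; last exact: del_edge_sym.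
by rewrite (deg_del_edge v ts tcd cd) addnAC.
Qed.

Lemma card_sum_bool (P : pred T) : #|[set u | P u]| = \sum_u (P u : nat).
Proof.
rewrite -sum1_card big_mkcond /=; apply: eq_bigr => u _.
by rewrite inE; case: (P u).
Qed.

Lemma card_darts t : #|[set p : T * T | t p.1 p.2]| = \sum_v deg t v.
Proof.
rewrite -sum1_card (eq_bigl (fun p : T * T => predT p.1 && t p.1 p.2)); last first.
  by move=> p; rewrite inE.
rewrite -(pair_big_dep predT (fun x y => t x y) (fun _ _ => 1)) /=.
by apply: eq_bigr => v _; rewrite sum1_card; apply: eq_card => y; rewrite !inE.
Qed.

Lemma sum_pick a : \sum_v (v == a : nat) = 1.
Proof.
rewrite (bigD1 a) //= eqxx big1 // => v va.
by rewrite (negPf va).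
Qed.

Lemma sum_deg_add_edge t a b : symmetric t -> a != b -> ~~ t a b ->
  \sum_v deg (add_edge t a b) v = \sum_v deg t v + 2.
Proof.
move=> ts ab tab.
rewrite (eq_bigr _ (fun v _ => deg_add_edge v ts ab tab)).
by rewrite big_split /= big_split /= !sum_pick.
Qed.

(* Adding one edge merges at most two components, so joining the [#|B|]
   components of [f] that meet [B] takes at least [#|B| - 1] further edges. *)
Lemma separated_bound f g B : symmetric f -> symmetric g -> irreflexive g ->
  subrel f g -> connected_graph g ->
  {in B &, forall x y, connect f x y -> x = y} ->
  2 * #|B| + \sum_v deg f v <= 2 + \sum_v deg g v.
Proof.
move=> + gs gi + gc; have [n] := ubnP (\sum_v deg g v - \sum_v deg f v).
elim: n f B => [|n IH] f B // hn fs fg hB.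
have [eqfg|] := boolP [forall x, forall y, g x y ==> f x y].
  have fgE : f =2 g.
    move=> x y; apply/idP/idP; first exact: fg.
    by move/forallP/(_ x)/forallP/(_ y)/implyP: eqfg.
  have : #|B| <= 1.
    apply/card_le1_eqP => x y xB yB; apply: hB => //.
    by rewrite (eq_connect fgE).
  have -> : \sum_v deg f v = \sum_v deg g v by apply: eq_bigr => v _; apply: eq_deg.
  by lia.
rewrite negb_forall => /existsP[a]; rewrite negb_forall => /existsP[b].
rewrite negb_imply => /andP[gab nfab].
have ab : a != b by apply: contraTneq gab => ->; rewrite gi.
have sf := sum_deg_add_edge fs ab nfab.
have sub : subrel (add_edge f a b) g.
  move=> x y /orP[/fg //|/orP[]/andP[/eqP-> /eqP->] //].
  by rewrite gs.
have le : \sum_v deg (add_edge f a b) v <= \sum_v deg g v.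
  apply: leq_sum => v _; apply: subset_leq_card; apply/subsetP => y.
  by rewrite !inE; apply: sub.
(* The new edge merges the components of [a] and [b]. Dropping the at most one vertex of [B] in the
   component of [a] keeps the rest separated. *)
pose B' := [set x in B | ~~ connect f a x].
have cs := sym_connect_sym fs.
have hB' : 2 * #|B'| + \sum_v deg (add_edge f a b) v <= 2 + \sum_v deg g v.
  apply: IH => //; [lia | exact: add_edge_sym |].
  move=> x y; rewrite !inE => /andP[xB nx] /andP[yB ny].
  case/connect_add_edge=> [|[h _]|[_ h]]; first exact: hB.
    by rewrite cs h in nx.
  by rewrite h in ny.
have : #|B :\: B'| <= 1.
  apply/card_le1_eqP => x y; rewrite !inE !negb_and !negbK.
  move=> /andP[/orP[/negPf->//|ax] xB] /andP[/orP[/negPf->//|ay] yB].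
  by apply: hB => //; apply: connect_trans ax; rewrite cs.
have := cardsID B' B.
have -> : B :&: B' = B' by apply/setIidPr/subsetP => x; rewrite inE => /andP[].
lia.
Qed.

Lemma deg1_unique t v u u' : deg t v = 1 -> t v u -> t v u' -> u = u'.
Proof.
move=> dv tu tu'; have /card_le1_eqP : deg t v <= 1 by rewrite dv.
by apply; rewrite inE.
Qed.

Lemma deg1P t v : deg t v = 1 -> exists u, t v u.
Proof.
move=> dv; have /card_gt0P[u] : 0 < deg t v by rewrite dv.
by rewrite inE; exists u.
Qed.

Lemma deg_gt1 t v u : t v u -> 1 < deg t v -> exists2 u', t v u' & u' != u.
Proof.
move=> tvu; rewrite /deg (cardsD1 u) inE tvu => /card_gt0P[u'].
by rewrite !inE => /andP[? ?]; exists u'.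
Qed.

Lemma deg_gt2 t v u u' : t v u -> t v u' -> 2 < deg t v ->
  exists u'', [/\ t v u'', u'' != u & u'' != u'].
Proof.
move=> tvu tvu' dv; have [E|n] := eqVneq u' u.
  by have [w tw wn] := deg_gt1 tvu (ltnW dv); exists w; rewrite E.
move: dv; rewrite /deg (cardsD1 u) (cardsD1 u') !inE n tvu tvu' /= !ltnS.
by case/card_gt0P=> w; rewrite !inE => /and3P[? ? ?]; exists w.
Qed.

Lemma three_deg t v u1 u2 u3 : t v u1 -> t v u2 -> t v u3 ->
  u1 != u2 -> u1 != u3 -> u2 != u3 -> 2 < deg t v.
Proof.
move=> t1 t2 t3 n12 n13 n23.
rewrite /deg (cardsD1 u1) (cardsD1 u2) (cardsD1 u3) !inE t1 t2 t3.
by rewrite !(eq_sym u3) (eq_sym u2 u1) n12 n13 n23.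
Qed.

Lemma two_deg t v u1 u2 : t v u1 -> t v u2 -> u1 != u2 -> 1 < deg t v.
Proof.
move=> t1 t2 n12; rewrite /deg (cardsD1 u1) (cardsD1 u2) !inE t1 t2.
by rewrite (eq_sym u2 u1) n12.
Qed.

Lemma deg2_unique t v u1 u2 u : deg t v = 2 -> t v u1 -> t v u2 -> u1 != u2 ->
  t v u -> u = u1 \/ u = u2.
Proof.
move=> dv t1 t2 n12 tu.
have [->|n1] := eqVneq u u1; first by left.
have [->|n2] := eqVneq u u2; first by right.
by have := three_deg t1 t2 tu n12; rewrite !(eq_sym _ u) n1 n2 dv => /(_ isT isT).
Qed.

End EdgeOperations.

(** * Cuts and edge exchanges in a spanning tree *)

Section Trees.
Variables (T : finType) (e : rel T).
Hypotheses (es : symmetric e) (ei : irreflexive e).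
Implicit Types (a b c d u v w x y z : T).

Section OneTree.
Variables (t : rel T) (tree : spanning_tree e t).

Let ts : symmetric t. Proof. by case: tree. Qed.
Let te : subrel t e. Proof. by case: tree. Qed.
Let tc : connected_graph t. Proof. by case: tree. Qed.
Let osym v : connect_sym (off t v). Proof. exact/sym_connect_sym/off_sym. Qed.
Let dsym c d : connect_sym (del_edge t c d).
Proof. exact/sym_connect_sym/del_edge_sym. Qed.

Lemma tree_neq x y : t x y -> x != y.
Proof. by move/te; apply: contraTneq => ->; rewrite ei. Qed.

Lemma tree_sum_deg : \sum_v deg t v = 2 * (#|T| - 1).
Proof. by rewrite -card_darts; case: tree. Qed.

(** Otherwise deleting the edge would leave a connected graph with [2 * (#|T| - 1) - 2] darts.
    [separated_bound], taken from the empty relation with all vertices as separated set, demands two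
    more. *)
Lemma tree_bridge c d : t c d -> ~~ connect (del_edge t c d) c d.
Proof.
move=> tcd; apply/negP => h.
have cd := tree_neq tcd.
have gc : connected_graph (del_edge t c d).
  move=> x y; apply: connect_sub (tc x y) => {}x {}y txy.
  have [/orP[]/andP[/eqP-> /eqP->]|nxy] := boolP (edge_of c d x y) => //.
    by rewrite dsym.
  by apply: connect1; rewrite /del_edge /= txy.
have gi : irreflexive (del_edge t c d).
  by move=> x; apply: contraTF isT => /andP[/tree_neq]; rewrite eqxx.
have h0 : {in [set: T] &, forall x y, connect (fun _ _ => false) x y -> x = y}.
  by move=> x y _ _ /connectP[[|z p] //= _ ->].
have := separated_bound _ (del_edge_sym c d ts) gi _ gc h0.
move/(_ (fun _ _ => erefl) (fun _ _ => False_rect _ \o notF)).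
rewrite cardsT big1; last first.
  by move=> v _; apply: eq_card0 => y; rewrite inE.
have : 0 < #|T| by apply/card_gt0P; exists c.
have := tree_sum_deg.
rewrite (eq_bigr _ (fun v _ => deg_del_edge v ts tcd cd)).
rewrite big_split /= big_split /= !sum_pick.
lia.
Qed.

Lemma off_del v u x : connect (off t v) u x -> connect (del_edge t u v) u x.
Proof.
apply: connect_sub => {x} x y /and3P[txy xv yv]; apply: connect1.
by rewrite /del_edge /edge_of /= txy (negPf xv) (negPf yv) andbF.
Qed.

Lemma off_delC v u x : connect (off t v) u x -> connect (del_edge t v u) u x.
Proof.
apply: connect_sub => {x} x y /and3P[txy xv yv]; apply: connect1.
by rewrite /del_edge /edge_of /= txy (negPf xv) (negPf yv) andbF.
Qed.

Lemma behind_refl v u : behind t v u u.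
Proof. exact: connect0. Qed.

Lemma toward v x : x != v -> exists2 u, t v u & behind t v u x.
Proof.
have /connectP[p0 pp0 ->] := tc v x.
case/shortenP: pp0 => [[|u p] /=]; first by rewrite eqxx.
case/andP=> tvu pp /andP[vp _] _ _; exists u => //.
apply/connectP; exists p => //.
apply: (@sub_in_path _ (predC1 v)) pp => [y z yv zv tyz|].
  by move: yv zv; rewrite !inE /off /= tyz => -> ->.
by apply/allP => y yp; rewrite inE; apply: contraNneq vp => <-.
Qed.

(** Two different such neighbours would be joined by a path avoiding [v], closing a cycle through
    the bridge [v u]. *)
Lemma behind_unique v u u' x : t v u -> t v u' ->
  behind t v u x -> behind t v u' x -> u = u'.
Proof.
move=> tvu tvu' h h'; apply/eqP/negPn/negP => uu'.
have k : connect (off t v) u u' by apply: connect_trans h _; rewrite osym.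
have /negP[] := tree_bridge tvu; rewrite dsym.
apply: connect_trans (off_delC k) _; apply: connect1.
rewrite /del_edge /edge_of /= ts tvu' !eqxx.
by rewrite !(eq_sym u') (negPf uu') (negPf (tree_neq tvu')).
Qed.

(** No vertex behind [w] seen from [u] is [v], as [v] already lies behind itself there; so the path
    also avoids [v]. *)
Lemma behind_step v u w x : t v u -> t u w -> w != v ->
  behind t u w x -> behind t v u x.
Proof.
move=> tvu tuw wv h.
have [uv uw] : u != v /\ u != w by rewrite eq_sym !tree_neq.
apply: (@connect_trans _ _ w).
  by apply: connect1; rewrite /off /= tuw uv.
have av z : behind t u w z -> z != v.
  apply: contraTneq => ->; apply/negP => hv.
  have tuv : t u v by rewrite ts.
  by have := behind_unique tuw tuv hv (behind_refl _ _) => E; rewrite E eqxx in wv.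
apply: connect_reachable h => z z' hz hzz'.
rewrite /off /=; case/and3P: (hzz') => -> _ _; rewrite !av //.
by apply: connect_trans hz (connect1 hzz').
Qed.

Lemma behind_excl c d x : t c d -> behind t c d x -> behind t d c x -> False.
Proof.
move=> tcd /off_delC h1 /off_del h2; have /negP[] := tree_bridge tcd.
by apply: connect_trans h2 _; rewrite dsym.
Qed.

Lemma behind_total c d x : t c d -> behind t c d x \/ behind t d c x.
Proof.
move=> tcd; have [->|xc] := eqVneq x c; first by right; apply: connect0.
have [u tcu hu] := toward xc.
have [<-|ud] := eqVneq u d; first by left.
by right; apply: behind_step tcu ud hu; rewrite ts.
Qed.

Lemma behind_leaf v y z : deg t y = 1 -> t v y -> behind t v y z -> z = y.
Proof.
move=> dy tvy h; have [//|zy] := eqVneq z y.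
have [w tyw hw] := toward zy.
have tyv : t y v by rewrite ts.
by rewrite (deg1_unique dy tyw tyv) in hw; case: (behind_excl tyv hw h).
Qed.

Lemma swap_nonedge a b c d : t c d -> behind t d c a -> behind t c d b ->
  ~~ connect (del_edge t c d) a b.
Proof.
move=> tcd /off_del ha /off_delC hb; apply/negP => hab.
have /negP[] := tree_bridge tcd.
by apply: connect_trans ha _; apply: connect_trans hab _; rewrite dsym.
Qed.

Lemma deg_tree_swap a b c d v :
  t c d -> behind t d c a -> behind t c d b ->
  deg (swap t a b c d) v + ((v == c) + (v == d)) =
    deg t v + ((v == a) + (v == b)).
Proof.
move=> tcd ha hb; have := swap_nonedge tcd ha hb => nab.
apply: deg_swap => //; first exact: tree_neq.
  by apply: contraNneq nab => ->; apply: connect0.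
by apply: contraNN nab => /connect1.
Qed.

(** The deleted edge is replaced by the detour from [c] to [a], across the new edge to [b], and on
    to [d]; the dart count is unchanged. *)
Lemma tree_swap a b c d : e a b ->
  t c d -> behind t d c a -> behind t c d b -> spanning_tree e (swap t a b c d).
Proof.
move=> eab tcd ha hb; split.
- exact: swap_sym.
- move=> x y /orP[/andP[/te] //|/orP[]/andP[/eqP-> /eqP->] //].
  by rewrite es.
- have ss := sym_connect_sym (swap_sym a b c d ts).
  have sub : subrel (connect (del_edge t c d)) (connect (swap t a b c d)).
    by apply: connect_sub => x y h; apply: connect1; rewrite /swap /add_edge /= h.
  have hca : connect (swap t a b c d) c a by apply/sub/off_del.
  have hdb : connect (swap t a b c d) d b.
    exact/sub/off_delC.
  have hcd : connect (swap t a b c d) c d.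
    apply: connect_trans hca _; rewrite ss; apply: connect_trans hdb _.
    by apply: connect1; rewrite /swap /add_edge /edge_of /= !eqxx orbT orbT.
  have all_c x : connect (swap t a b c d) c x.
    apply: connect_sub (tc c x) => y z tyz.
    have [/orP[]/andP[/eqP-> /eqP->]|nyz] := boolP (edge_of c d y z) => //.
      by rewrite ss.
    by apply/sub/connect1; rewrite /del_edge /= tyz.
  by move=> x y; apply: connect_trans (all_c y); rewrite ss.
rewrite card_darts.
have := tree_sum_deg.
have : \sum_v (deg (swap t a b c d) v + ((v == c) + (v == d))) =
       \sum_v (deg t v + ((v == a) + (v == b))).
  by apply: eq_bigr => v _; apply: deg_tree_swap.
rewrite !big_split /= !sum_pick; lia.
Qed.


Lemma tree_deg_gt0 v x : x != v -> 0 < deg t v.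
Proof.
by case/toward=> u tvu _; apply/card_gt0P; exists u; rewrite inE.
Qed.

(* Take the cut with [x], [z] on the side of [c] and that side as small as
   possible: the paths from [c] to [x] and to [z] then diverge at [c]. *)
Lemma branch_separating x y z c d : deg t x = 1 -> deg t z = 1 -> x != z ->
  t c d -> behind t d c x -> behind t d c z -> behind t c d y ->
  exists c' d',
    [/\ t c' d', 2 < deg t c', behind t d' c' x & behind t c' d' y].
Proof.
move=> dx dz xz; have [n] := ubnP #|[set v | behind t d c v]|.
elim: n c d => // n IH c d hn tcd hx hz hy.
have tdc : t d c by rewrite ts.
have [E|xc] := eqVneq x c.
  by rewrite -E in hz tdc; case/eqP: xz; rewrite (behind_leaf dx tdc hz).
have [E|zc] := eqVneq z c.
  by rewrite -E in hx tdc; case/eqP: xz; rewrite (behind_leaf dz tdc hx).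
have [u tcu hu] := toward xc; have [u' tcu' hu'] := toward zc.
have du : d != u by apply: contraPneq (hu) => <- /behind_excl; apply.
have du' : d != u' by apply: contraPneq (hu') => <- /behind_excl; apply.
have [uu'|uu'] := eqVneq u u'; last first.
  by exists c, d; split=> //; apply: three_deg tcd tcu tcu' _ _ _.
have tuc : t u c by rewrite ts.
(* Both paths continue through [u], so the cut moves on to the edge [u c]; its side shrinks because
   it loses [c]. *)
apply: (IH u c) => //; last by apply: behind_step hy.
  apply: leq_trans (proper_card _) (hn : _ <= n); apply/properP; split.
    by apply/subsetP=> v; rewrite !inE; apply: behind_step; rewrite // eq_sym.
  exists c; rewrite !inE ?behind_refl //; apply/negP=> h.
  by have := behind_neq h; rewrite eqxx eq_sym (tree_neq tcu) => /(_ isT).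
by rewrite uu'.
Qed.

End OneTree.

(** * Spanning trees with the fewest leaves *)

(** Having three leaves is built in: it gives positive degrees and a third leaf next to any two. *)
Definition fewest_leaves t :=
  [/\ spanning_tree e t, 2 < #|leaves t| &
     forall t', spanning_tree e t' -> #|leaves t| <= #|leaves t'|].

Lemma leafE t v : (v \in leaves t) = (deg t v == 1).
Proof. by rewrite inE. Qed.

Lemma fewest_deg_gt0 t v : fewest_leaves t -> 0 < deg t v.
Proof.
case=> tree /ltnW/card_gt1P[x [y [_ _ xy]]] _.
have [E|xv] := eqVneq x v; last exact: tree_deg_gt0 tree _ _ xv.
by apply: (tree_deg_gt0 tree (x := y)); rewrite -E eq_sym.
Qed.

(** The leaves of [t'] would lie among those of [t] without [x]. Positivity of [deg t v] is supplied
    so that callers can conclude by degree arithmetic. *)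
Lemma fewer_leaves_absurd t t' x : fewest_leaves t -> spanning_tree e t' ->
  deg t x = 1 ->
  (forall v, 0 < deg t v -> deg t' v = 1 -> deg t v = 1 /\ v != x) -> False.
Proof.
move=> fl tree' dx h; have [_ _ /(_ _ tree')] := fl.
have : leaves t' \subset leaves t :\ x.
  apply/subsetP=> v; rewrite in_setD1 !leafE => /eqP /h[]; first exact: fewest_deg_gt0.
  by move=> -> ->.
move/subset_leq_card; rewrite (cardsD1 x (leaves t)) leafE dx eqxx; lia.
Qed.

(** At most [z] replaces the leaf [x], so [t'] is again minimal and results on minimal trees apply
    to it. Taking [z] equal to [x] covers exchanges that create no new leaf. *)
Lemma fewest_leaves_move t t' x z : fewest_leaves t -> spanning_tree e t' ->
  deg t x = 1 ->
  (forall v, 0 < deg t v -> deg t' v = 1 -> v = z \/ deg t v = 1 /\ v != x) ->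
  fewest_leaves t'.
Proof.
move=> fl tree' dx h; have [_ h3 hmin] := fl.
have le : #|leaves t'| <= #|leaves t|.
  have : leaves t' \subset z |: (leaves t :\ x).
    apply/subsetP=> v; rewrite in_setU1 in_setD1 !leafE => /eqP /h[].
    - exact: fewest_deg_gt0.
    - by move=> ->; rewrite eqxx.
    by case=> -> ->; rewrite orbT.
  move/subset_leq_card/leq_trans; apply.
  rewrite cardsU1 (cardsD1 x (leaves t)) leafE dx eqxx.
  by rewrite leq_add2r leq_b1.
split=> //; first exact: leq_trans h3 (hmin _ tree').
by move=> t2 /hmin; apply: leq_trans.
Qed.

(** At the branch vertex [c'] where the paths from [y] to [x] and to a third leaf part, exchange the
    edge [c' d] towards [y] for [x y]. Of the new leaves only [d] can be outside the old ones other
    than [x] and [y], so the count drops. *)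
Lemma leaves_nonadjacent t x y : fewest_leaves t ->
  deg t x = 1 -> deg t y = 1 -> ~~ e x y.
Proof.
move=> fl dx dy; apply/negP=> exy; have [tree h3 hmin] := fl.
have [ts _ _ _] := tree.
have xy : x != y by apply: contraTneq exy => ->; rewrite ei.
have [z dz /andP[zx zy]] : exists2 z, deg t z = 1 & (z != x) && (z != y).
  move: h3; rewrite (cardsD1 x) (cardsD1 y) !inE dx dy eq_sym xy /= !ltnS.
  by case/card_gt0P=> z; rewrite !inE => /and3P[? ? /eqP ?]; exists z => //; apply/andP.
have [c tyc] := deg1P dy; have tcy : t c y by rewrite ts.
have away w : w != y -> behind t y c w.
  move=> wy; case: (behind_total tree w tcy) => // h.
  by rewrite (behind_leaf tree dy tcy h) eqxx in wy.
have := branch_separating tree dx dz _ tcy (away x xy) (away z zy) (behind_refl _ _ _).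
rewrite eq_sym => /(_ zx)[c' [d [tcd dc hx hy]]].
have tree' := tree_swap tree exy tcd hx hy.
have D v := deg_tree_swap tree v tcd hx hy.
have cd := tree_neq tree tcd.
have xd : x != d by apply: (behind_neq hx).
have : leaves (swap t x y c' d) \subset d |: (leaves t :\ x :\ y).
  apply/subsetP=> v; rewrite !inE => /eqP hv; move: (D v); rewrite hv.
  have [//|vd] /= := eqVneq v d.
  have [xc yc] : x != c' /\ y != c'.
    by split; apply: contraTneq dc => <-; rewrite ?dx ?dy.
  have [->|vx] := eqVneq v x; first by rewrite (negPf xy) (negPf xc) dx.
  have [->|vy] := eqVneq v y; first by rewrite (negPf yc) dy.
  have [->|vc] := eqVneq v c'; first by move: dc; clear; lia.
  by rewrite !addn0 => <-.
move/subset_leq_card; rewrite cardsU1.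
have := hmin _ tree'.
rewrite (cardsD1 x (leaves t)) (cardsD1 y (leaves t :\ x)) !inE dx dy eqxx eq_sym xy.
by have := leq_b1 (d \notin leaves t :\ x :\ y); rewrite !inE; clear; lia.
Qed.

Lemma neq_edge x y : e x y -> x != y.
Proof. by apply: contraTneq => ->; rewrite ei. Qed.

(** Exchanging [c u] for [x u] keeps the degree of [u] and turns [x] into an inner vertex; a branch
    vertex [c] would not become a leaf in return. *)
Lemma leaf_neighbour_pred_deg t x u c : fewest_leaves t -> deg t x = 1 ->
  e x u -> t c u -> behind t u c x -> deg t c <= 2.
Proof.
move=> fl dx exu tcu hx; rewrite leqNgt; apply/negP=> dc; have [tree _ _] := fl.
have h := behind_refl t c u.
apply: (fewer_leaves_absurd fl (tree_swap tree exu tcu hx h) dx) => v _ hv.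
have := deg_tree_swap tree v tcu hx h; rewrite hv.
have xc : x == c = false by apply: contraTF dc => /eqP<-; rewrite dx.
have [->|vx] := eqVneq v x; first by rewrite xc dx; deg_lia.
by have [->|vc] := eqVneq v c; move: dc; deg_lia.
Qed.

(** The same exchange makes [c], of degree two, a leaf of another minimal tree that keeps the leaf
    [y]; leaves of that tree are nonadjacent. *)
Lemma leaf_neighbour_pred t x u c y : fewest_leaves t -> deg t x = 1 ->
  e x u -> t c u -> behind t u c x -> c != x ->
  deg t y = 1 -> y != x -> ~~ e c y.
Proof.
move=> fl dx exu tcu hx cx dy yx; apply/negP=> ecy; have [tree _ _] := fl.
have [ts _ _ _] := tree; have tuc : t u c by rewrite ts.
have h := behind_refl t c u; have cy := neq_edge ecy.
have tree' := tree_swap tree exu tcu hx h.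
have D v := deg_tree_swap tree v tcu hx h.
have dc2 := leaf_neighbour_pred_deg fl dx exu tcu hx.
have dc0 := fewest_deg_gt0 c fl.
have dc1 : deg t c != 1.
  by apply: contraNneq cx => dc; rewrite (behind_leaf tree dc tuc hx).
have fl' : fewest_leaves (swap t x u c u).
  apply: (fewest_leaves_move (x := x) (z := c) fl tree' dx) => v _ hv.
  have := D v; rewrite hv; have [->|vc] := eqVneq v c; first by left.
  by have [->|vx] := eqVneq v x; move: dx; deg_lia.
have dc' : deg (swap t x u c u) c = 1.
  by have := D c; rewrite eqxx (negPf cx); move: dc0 dc1 dc2; deg_lia.
have dy' : deg (swap t x u c u) y = 1.
  by have := D y; rewrite (negPf yx) [y == c]eq_sym (negPf cy); move: dy; deg_lia.
by have := leaves_nonadjacent fl' dc' dy'; rewrite ecy.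
Qed.

Lemma off_swap (t : rel T) a b v u : subrel (off t v) (off (swap t a b v u) v).
Proof.
move=> x y /and3P[txy xv yv].
by rewrite /off /swap /add_edge /del_edge /edge_of /= txy (negPf xv) (negPf yv) andbF.
Qed.

Lemma behind_swap (t : rel T) a b v u q x :
  behind t v q x -> behind (swap t a b v u) v q x.
Proof. by apply: connect_sub => y z /off_swap h; apply: connect1. Qed.

Lemma swap_kept (t : rel T) a b c d x y : 
  t x y -> ~~ edge_of c d x y -> swap t a b c d x y.
Proof. by move=> txy h; rewrite /swap /add_edge /del_edge /= txy h. Qed.

Lemma behind_nbr t v u q : spanning_tree e t -> t v u -> t v q -> u != q ->
  behind t u v q.
Proof.
move=> tree tvu tvq uq; apply: connect1.
by rewrite /off /= tvq (tree_neq tree tvu) eq_sym uq.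
Qed.

(** Otherwise [u] could be re-hung from [v] to [q]. The tree stays minimal, but [q] becomes a branch
    vertex preceding [v] on the path from [y], against [leaf_neighbour_pred_deg]. *)
Lemma branch_nbr_nonadjacent t y v q u : fewest_leaves t -> deg t y = 1 ->
  e y v -> t v q -> q != y -> behind t v q y -> 2 < deg t v ->
  t v u -> u != q -> ~~ e q u.
Proof.
move=> fl dy eyv tvq qy hy dv tvu uq; apply/negP=> equ; have [tree _ _] := fl.
have [ts _ _ _] := tree.
have ha := behind_nbr tree tvu tvq uq.
have hb := behind_refl t v u.
have tree' := tree_swap tree equ tvu ha hb.
have D w := deg_tree_swap tree w tvu ha hb.
have fl' : fewest_leaves (swap t q u v u).
  apply: (fewest_leaves_move (x := y) (z := y) fl tree' dy) => w w0 hw.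
  have := D w; rewrite hw; have [->|wy] := eqVneq w y; first by left.
  by have [->|wv] := eqVneq w v; move: dv w0; rewrite ?wy; deg_lia.
have yv := neq_edge eyv; have vq := tree_neq tree tvq.
have dy' : deg (swap t q u v u) y = 1.
  by have := D y; rewrite (negPf yv) [y == q]eq_sym (negPf qy); move: dy; deg_lia.
have dq1 : deg t q != 1.
  by apply: contraNneq qy => dq; rewrite (behind_leaf tree dq tvq hy).
have dq0 := fewest_deg_gt0 q fl.
have tqv : swap t q u v u q v.
  apply: swap_kept; first by rewrite ts.
  rewrite /edge_of /=.
  by rewrite [q == v]eq_sym (negPf vq) [q == u]eq_sym (negPf uq).
have := leaf_neighbour_pred_deg fl' dy' eyv tqv (behind_swap _ _ _ hy).
have := D q; rewrite eqxx [q == v]eq_sym (negPf vq); move: dq0 dq1; deg_lia.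
Qed.

(** * Exchanges forced by the absence of an induced $K_{1,4}$ *)

Hypothesis k14 : K14_free e.

Lemma K14_edge c x1 x2 x3 x4 : e c x1 -> e c x2 -> e c x3 -> e c x4 ->
  uniq [:: x1; x2; x3; x4] ->
  [|| e x1 x2, e x1 x3, e x1 x4, e x2 x3, e x2 x4 | e x3 x4].
Proof.
move=> e1 e2 e3 e4 un; apply: contraT; rewrite !negb_or.
move=> /and5P[n12 n13 n14 n23 /andP[n24 n34]].
case: k14; exists c, [set:: [:: x1; x2; x3; x4]]; split.
- by rewrite cardsE (card_uniqP un).
- by move=> y; rewrite !inE => /or4P[]/eqP->.
move=> x y; rewrite !inE => /or4P[]/eqP-> /or4P[]/eqP-> //; rewrite ?ei // es //.
Qed.

(* When [deg t v = 2], [v] can be cut out of its path and hung at the end of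
   [y], where it becomes a leaf adjacent to [y']. *)
Lemma behind_leaf_unique t v q y y' : fewest_leaves t -> t v q ->
  deg t y = 1 -> deg t y' = 1 -> e y v -> e y' v ->
  behind t v q y -> behind t v q y' -> y = y'.
Proof.
move=> fl tvq dy dy' eyv eyv' hy hy'; apply/eqP/negPn/negP=> yy'.
have [tree _ _] := fl; have [ts te _ _] := tree.
have tqv : t q v by rewrite ts.
have qy : q != y.
  by apply: contraNneq yy' => E; subst; rewrite (behind_leaf tree dy tvq hy').
have qy' : q != y'.
  by apply: contraNneq yy' => E; subst; rewrite (behind_leaf tree dy' tvq hy).
have nyq : ~~ e q y by apply: (leaf_neighbour_pred fl dy' eyv' tqv hy').
have nyq' : ~~ e q y'.
  by apply: (leaf_neighbour_pred fl dy eyv tqv hy); rewrite // eq_sym.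
have evy : e v y by rewrite es.
have evy' : e v y' by rewrite es.
have dv : 1 < deg t v.
  rewrite ltn_neqAle fewest_deg_gt0 // andbT eq_sym; apply/eqP=> dv.
  by have := leaves_nonadjacent fl dv dy; rewrite evy.
have [u tvu uq] := deg_gt1 tvq dv; have tuv : t u v by rewrite ts.
have qu : q != u by rewrite eq_sym.
have far z : behind t v q z -> behind t u v z /\ u != z.
  move=> hz; split; first by apply: behind_step hz.
  by apply: contraNneq uq => E; subst;
     rewrite (behind_unique tree tvq tvu hz (behind_refl _ _ _)).
have [huy uy] := far y hy; have [huy' uy'] := far y' hy'.
have nuy : ~~ e y u.
  apply/negP=> eyu; have := leaf_neighbour_pred fl dy eyu tvu huy _ dy'.
  by rewrite evy' eq_sym neq_edge // eq_sym yy' => /(_ isT isT).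
have nuy' : ~~ e y' u.
  apply/negP=> eyu; have := leaf_neighbour_pred fl dy' eyu tvu huy' _ dy.
  by rewrite evy eq_sym neq_edge // yy' => /(_ isT isT).
have nyy' := leaves_nonadjacent fl dy dy'.
(* Among the neighbours [y], [y'], [q], [u] of [v], every other pair is already known to be
   nonadjacent. *)
have equ : e q u.
  have := K14_edge evy evy' (te _ _ tvq) (te _ _ tvu).
  rewrite (negPf nyy') (negPf nuy) (negPf nuy') es (negPf nyq) es (negPf nyq') /=.
  apply; rewrite !inE (negPf yy') ![_ == q]eq_sym (negPf qy) (negPf qy').
  by rewrite !(eq_sym _ u) (negPf uy) (negPf uy') uq.
have [dv3|dv2] := ltnP 2 (deg t v).
  by have := branch_nbr_nonadjacent fl dy eyv tvq qy hy dv3 tvu uq; rewrite equ.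
have ha := behind_nbr tree tvu tvq uq; have hb := behind_refl t v u.
have tree1 := tree_swap tree equ tvu ha hb.
have D1 w := deg_tree_swap tree w tvu ha hb.
set t1 := swap t q u v u in tree1 D1.
have t1vq : t1 v q.
  apply: swap_kept; rewrite // /edge_of /= eqxx (negPf qu).
  by rewrite (negPf (tree_neq tree tvu)).
have hy1 : behind t1 v q y by apply: behind_swap.
have hv1 := behind_refl t1 q v.
have tree2 := tree_swap tree1 evy t1vq hv1 hy1.
have D2 w := deg_tree_swap tree1 w t1vq hv1 hy1.
have yv := neq_edge eyv; have yv' := neq_edge eyv'.
have fl2 : fewest_leaves (swap t1 v y v q).
  apply: (fewest_leaves_move (x := y) (z := v) fl tree2 dy) => w w0 hw.
  have := D1 w; have := D2 w; rewrite hw.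
  have [->|wv] := eqVneq w v; first by left.
  by have [->|wy] := eqVneq w y; rewrite ?dy; deg_lia.
have dv' : deg (swap t1 v y v q) v = 1.
  have := D1 v; have := D2 v; rewrite eqxx [v == y]eq_sym (negPf yv).
  by move: dv dv2; deg_lia.
have dy2 : deg (swap t1 v y v q) y' = 1.
  have := D1 y'; have := D2 y'.
  by rewrite (negPf yv') [y' == y]eq_sym (negPf yy') dy'; deg_lia.
by have := leaves_nonadjacent fl2 dv' dy2; rewrite evy'.
Qed.

(* Re-hang one further neighbour [u2] of [w] on the neighbour [u1] that leads
   to [x], then replace the edge [u1 w] by [x w']: either a leaf is lost, or
   [w] becomes a leaf, adjacent to [y]. *)
Lemma no_facing_branches t w q y w' x : fewest_leaves t ->
  2 < deg t w -> t w q -> deg t q = 2 ->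
  deg t y = 1 -> e y w -> behind t w q y -> behind t w q w' -> w' != q ->
  deg t x = 1 -> e x w' -> behind t q w x -> False.
Proof.
move=> fl dw twq dq dy eyw hy hw' wq' dx exw' hx.
have [tree _ _] := fl; have [ts te _ _] := tree.
have tqw : t q w by rewrite ts.
have qy : q != y by apply: contraTneq isT => E; rewrite E dy in dq.
have yx : y != x.
  by apply: contraTneq isT => E; subst; case: (behind_excl tree twq hy hx).
have xw : x != w by apply: contraTneq dw => <-; rewrite dx.
have yw := neq_edge eyw; have ewy : e w y by rewrite es.
have w'w : w' != w by apply: behind_neq hw' _; rewrite eq_sym (tree_neq tree).
have w'x : w' != x by rewrite eq_sym neq_edge.
have w'y : w' != y.
  by apply: contraTneq exw' => ->; apply: leaves_nonadjacent fl dx dy.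
(* Exchanging [w q] for [x w'] would make [q], of degree two, a leaf in place of [x], adjacent to
   the leaf [y]. *)
have nqy : ~~ e q y.
  apply/negP=> eqy; have tree' := tree_swap tree exw' twq hx hw'.
  have D v := deg_tree_swap tree v twq hx hw'.
  have wq := tree_neq tree twq.
  have fl' : fewest_leaves (swap t x w' w q).
    apply: (fewest_leaves_move (x := x) (z := q) fl tree' dx) => v v0 hv.
    have := D v; rewrite hv; have [->|vq] := eqVneq v q; first by left.
    have [->|vx] := eqVneq v x; first by rewrite (negPf xw) dx; deg_lia.
    by have [->|vw] := eqVneq v w; move: dw v0; deg_lia.
  have dq' : deg (swap t x w' w q) q = 1.
    have xq : q == x = false by apply: contraTF isT => /eqP E; rewrite E dx in dq.
    have := D q; rewrite eqxx [q == w]eq_sym (negPf wq) [q == w']eq_sym (negPf wq').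
    by rewrite xq dq; deg_lia.
  have dy' : deg (swap t x w' w q) y = 1.
    have := D y; rewrite (negPf yw) [y == q]eq_sym (negPf qy) (negPf yx).
    by rewrite [y == w']eq_sym (negPf w'y) dy; deg_lia.
  by have := leaves_nonadjacent fl' dq' dy'; rewrite eqy.
have [u1 twu1 hu1] := toward tree xw.
have u1q : u1 != q.
  by apply: contraTneq isT => E; rewrite E in hu1; case: (behind_excl tree twq hu1 hx).
have [u2 [twu2 u21 u2q]] := deg_gt2 twu1 twq dw.
have side u : t w u -> u != q -> [/\ u != y, ~~ e y u & ~~ e q u].
  move=> twu uq; have tuw : t u w by rewrite ts.
  have qu : q != u by rewrite eq_sym.
  split.
  - apply: contraNneq uq => E; subst.
    by rewrite (behind_unique tree twq twu hy (behind_refl _ _ _)).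
  - apply/negP=> eyu; have h : behind t u w y by apply: behind_step hy.
    by have := leaf_neighbour_pred_deg fl dy eyu twu h; rewrite leqNgt dw.
  exact: branch_nbr_nonadjacent fl dy eyw twq qy hy dw twu uq.
have [u1y neyu1 nequ1] := side _ twu1 u1q.
have [u2y neyu2 nequ2] := side _ twu2 u2q.
have e12 : e u1 u2.
  have := K14_edge (te _ _ twq) ewy (te _ _ twu1) (te _ _ twu2).
  rewrite (negPf nqy) (negPf nequ1) (negPf nequ2) (negPf neyu1) (negPf neyu2) /=.
  apply; rewrite !inE (negPf qy) !(eq_sym q) (negPf u1q) (negPf u2q).
  by rewrite !(eq_sym y) (negPf u1y) (negPf u2y) eq_sym u21.
have ha := behind_nbr tree twu2 twu1 u21; have hb := behind_refl t w u2.
have tree1 := tree_swap tree e12 twu2 ha hb.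
have D1 v := deg_tree_swap tree v twu2 ha hb.
set t1 := swap t u1 u2 w u2 in tree1 D1.
have wu1 := tree_neq tree twu1; have wu2 := tree_neq tree twu2.
have t1wu1 : t1 w u1.
  by apply: swap_kept; rewrite // /edge_of /= eqxx [u1 == u2]eq_sym (negPf u21)
     (negPf wu2).
have t1wq : t1 w q.
  by apply: swap_kept; rewrite // /edge_of /= eqxx [q == u2]eq_sym (negPf u2q)
     (negPf wu2).
have [ts1 _ _ _] := tree1.
have t1u1w : t1 u1 w by rewrite ts1.
have hx1 : behind t1 w u1 x by apply: behind_swap.
have hw1 : behind t1 u1 w w'.
  apply: (behind_step tree1 t1u1w t1wq); first by rewrite eq_sym.
  exact: behind_swap.
have tree2 := tree_swap tree1 exw' t1u1w hx1 hw1.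
have D2 v := deg_tree_swap tree1 v t1u1w hx1 hw1.
set t2 := swap t1 x w' u1 w in tree2 D2.
(* Over both exchanges [u1] and [u2] each gain and lose one edge, and [w] loses its edges to
   both. *)
have D v : deg t2 v + (v == w) * 2 = deg t v + ((v == x) + (v == w')).
  by have := D1 v; have := D2 v; deg_lia.
have [dw4|dw3] := ltnP 3 (deg t w).
  apply: (fewer_leaves_absurd fl tree2 dx) => v v0 hv; have := D v; rewrite hv.
  have [->|vx] := eqVneq v x; first by rewrite (negPf xw) dx; deg_lia.
  by have [->|vw] := eqVneq v w; move: dw4 v0; deg_lia.
have fl2 : fewest_leaves t2.
  apply: (fewest_leaves_move (x := x) (z := w) fl tree2 dx) => v v0 hv.
  have := D v; rewrite hv; have [->|vw] := eqVneq v w; first by left.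
  by have [->|vx] := eqVneq v x; rewrite ?dx; move: v0; deg_lia.
have dw2 : deg t2 w = 1.
  have := D w; rewrite eqxx [w == x]eq_sym (negPf xw) [w == w']eq_sym (negPf w'w).
  by move: dw dw3; deg_lia.
have dy2 : deg t2 y = 1.
  by have := D y; rewrite (negPf yw) (negPf yx) [y == w']eq_sym (negPf w'y) dy; deg_lia.
by have := leaves_nonadjacent fl2 dw2 dy2; rewrite ewy.
Qed.

(** * Marked darts and the forest they form *)

Section ActiveEdges.
Variables (t : rel T) (fl : fewest_leaves t).

Let tree : spanning_tree e t. Proof. by case: fl. Qed.
Let ts : symmetric t. Proof. by case: tree. Qed.

(** The marked darts; [active_edge] forgets their direction. *)
Definition active v u :=
  [exists y, [&& deg t y == 1, e y v, t v u & behind t v u y]].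

Definition active_edge : rel T := [rel u v | active u v || active v u].

Lemma activeP v u : reflect
  (exists y, [/\ deg t y = 1, e y v, t v u & behind t v u y]) (active v u).
Proof.
apply: (iffP existsP) => [][y].
  by case/and4P=> /eqP ? ? ? ?; exists y.
by case=> ? ? ? ?; exists y; apply/and4P; split=> //; apply/eqP.
Qed.

Lemma active_head v u : active v u -> deg t u <= 2.
Proof.
case/activeP=> y [dy eyv tvu hy]; have tuv : t u v by rewrite ts.
exact: leaf_neighbour_pred_deg fl dy eyv tuv hy.
Qed.

(** If [y] marks the dart from [v] to [u], then [u] precedes [v] on the path from [y], so
    [leaf_neighbour_pred] denies [u] the other leaf needed to mark the reverse dart. If [u] is [y]
    itself, two leaves would be adjacent. *)
Lemma active_asym v u : active v u -> active u v -> False.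
Proof.
case/activeP=> y [dy eyv tvu hy] /activeP[z [dz ezu tuv hz]].
have [E|uy] := eqVneq u y.
  by have := leaves_nonadjacent fl dz dy; rewrite -E ezu.
have zy : z != y.
  by apply: contraTneq isT => E; subst; case: (behind_excl tree tvu hy hz).
by have := leaf_neighbour_pred fl dy eyv tuv hy uy dz zy; rewrite es ezu.
Qed.

Lemma active_edge_sym : symmetric active_edge.
Proof. by move=> x y; rewrite /active_edge /= orbC. Qed.

Lemma active_edge_sub : subrel active_edge t.
Proof.
move=> x y /orP[] /activeP[z [_ _]]; first by [].
by rewrite ts.
Qed.

Lemma active_edge_branch c w : active_edge c w -> 2 < deg t w -> active w c.
Proof. by case/orP=> // /active_head; rewrite leqNgt => /negPf->. Qed.

(** Take for [w] the first branch vertex from [b] on, and for [c] its predecessor. The vertices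
    passed before [w] have degree two, so a leaf on the side of [c] must lie beyond [a]. *)
Lemma next_branch p a b : active_edge a b -> path active_edge b p ->
  uniq (a :: b :: p) -> 2 < deg t (last b p) ->
  exists w c, [/\ 2 < deg t w, active_edge c w, behind t a b w &
    forall x, deg t x = 1 -> behind t w c x -> behind t b a x].
Proof.
elim: p a b => [|b' p IH] a b ab /=; first by move=> _ _ db; exists b, a; rewrite behind_refl.
move=> /andP[bb' pp] un lp.
have [db|db] := ltnP 2 (deg t b); first by exists b, a; rewrite behind_refl.
have /andP[_ un'] := un.
have [w [c [dw cw hw hx]]] := IH _ _ bb' pp un' lp.
have ab' : a != b' by apply: contraTneq un => ->; rewrite !inE eqxx orbT.
have tbb' := active_edge_sub bb'; have tab := active_edge_sub ab.
have tba : t b a by rewrite ts.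
exists w, c; split=> //.
  by apply: (behind_step tree tab tbb'); rewrite // eq_sym.
move=> x dx /(hx _ dx) hbx.
have db2 : deg t b = 2.
  by apply/eqP; rewrite eqn_leq db (two_deg tba tbb' ab').
have xb : x != b by apply: contraTneq isT => E; rewrite -E dx in db2.
have [u tbu hu] := toward tree xb.
case: (deg2_unique db2 tba tbb' ab' tbu) => E; rewrite E in hu; first by [].
by case: (behind_excl tree tbb' hu hbx).
Qed.

(** Heads of marked darts are not branch vertices, so on the stretch from [w] to the next branch
    vertex both end edges are marked inwards. The marking leaves [y] and [x] give the configuration
    of [no_facing_branches]. *)
Lemma branches_separated :
  {in branches t &, forall w w', connect active_edge w w' -> w = w'}.
Proof.
move=> w w2; rewrite !inE => dw dw2 /connectP[p0 pp0 E2].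
rewrite E2 in dw2 *; case/shortenP: pp0 dw2 => [[//|q p]] /= /andP[wq pp] un _ dl.
have [w' [c [dw' cw' hw' hx]]] := next_branch wq pp un dl.
have /activeP[x [dx exw' tw'c hcx]] := active_edge_branch cw' dw'.
have qw : active_edge q w by rewrite active_edge_sym.
have awq := active_edge_branch qw dw; have dq2 := active_head awq.
have /activeP[y [dy eyw twq hy]] := awq.
have w'q : w' != q by apply: contraTneq dw' => ->; rewrite -leqNgt.
have dq1 : deg t q != 1.
  by apply: contraNneq w'q => dq; rewrite (behind_leaf tree dq twq hw').
have dq : deg t q = 2.
  by have := fewest_deg_gt0 q fl; move: dq1 dq2; deg_lia.
by case: (no_facing_branches fl dw twq dq dy eyw hy hw' w'q dx exw' (hx _ dx hcx)).
Qed.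

(** Send each leaf adjacent to [v] to the neighbour of [v] towards it; [behind_leaf_unique] makes
    this injective. *)
Lemma card_leaf_nbrs v :
  #|[set y in leaves t | e y v]| <= #|[set u | active v u]|.
Proof.
(* The default [v] is never taken for a [y] adjacent to [v]. *)
pose f y := odflt v [pick u | t v u && behind t v u y].
have fP y : e y v -> t v (f y) /\ behind t v (f y) y.
  move=> eyv; rewrite /f; case: pickP => [u /andP[] //|no].
  have [u tvu hu] := toward tree (neq_edge eyv).
  by have := no u; rewrite tvu hu.
rewrite -(card_in_imset (f := f)); last first.
  move=> y z; rewrite !inE => /andP[/eqP dy eyv] /andP[/eqP dz ezv] E.
  have [ty hy] := fP _ eyv; have [tz hz] := fP _ ezv.
  by rewrite -E in hz; apply: behind_leaf_unique hy hz.
apply/subset_leq_card/subsetP=> u /imsetP[y]; rewrite !inE => /andP[/eqP dy eyv] ->.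
by have [ty hy] := fP _ eyv; apply/activeP; exists y.
Qed.

Lemma leaf_degrees_bound : \sum_(y in leaves t) deg e y + #|branches t| <= #|T|.
Proof.
have gi : irreflexive t.
  by move=> x; apply: contraTF isT => /(tree_neq tree); rewrite eqxx.
have [_ _ tc _] := tree.
have := separated_bound active_edge_sym ts gi active_edge_sub tc branches_separated.
rewrite (tree_sum_deg tree).
(* By [active_asym] each edge carries exactly one mark, so the degree sum is twice the number of
   marked darts. Halving [separated_bound] then gives the claim. *)
have -> : \sum_v deg active_edge v =
    \sum_v #|[set u | active v u]| + \sum_v #|[set u | active v u]|.
  rewrite [X in _ = _ + X](eq_bigr _ (fun v _ => card_sum_bool (active v))).
  rewrite exchange_big -big_split /=; apply: eq_bigr => v _.
  rewrite /deg !card_sum_bool -big_split /=; apply: eq_bigr => u _.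
  rewrite /active_edge /=.
  case: (boolP (active v u)) => a1; case: (boolP (active u v)) => a2 //.
  by case: (active_asym a1 a2).
have : \sum_(y in leaves t) deg e y <= \sum_v #|[set u | active v u]|.
  rewrite (eq_bigr _ (fun y _ => card_sum_bool (e y))).
  rewrite exchange_big /=; apply: leq_sum => v _.
  apply: leq_trans (card_leaf_nbrs v).
  rewrite -sum1_card big_mkcond [X in _ <= X]big_mkcond /=.
  by apply: leq_sum => y _; rewrite !inE; case: eqP => //= _; case: (e y v).
have : 0 < #|T|.
  by have [_ /ltnW/ltnW/card_gt0P[x _] _] := fl; apply/card_gt0P; exists x.
move: (\sum_(y in leaves t) deg e y) (\sum_v #|_|); clear; lia.
Qed.

End ActiveEdges.
End Trees.

(** * Existence of a minimal tree, and the final count *)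

Section MainTheorem.
Variable T : finType.
Implicit Types (e t : rel T) (u v x y : T).

(** Grow the tree from [r], adding at each stage an edge of [e] that leaves [A]. Since [t] stays
    inside [A], that edge is new and adds two darts. *)
Lemma partial_spanning_tree e r k : symmetric e -> connected_graph e -> k < #|T| ->
  exists t (A : {set T}),
    [/\ symmetric t, subrel t e, forall x, x \in A -> connect t r x,
        forall x y, t x y -> x \in A &
        #|A| = k.+1 /\ \sum_v deg t v = 2 * k] /\ r \in A.
Proof.
move=> es ec; elim: k => [|k IH] kT.
  exists (fun _ _ => false), [set r]; split; last by rewrite inE.
  split=> //; first by move=> x; rewrite inE => /eqP->.
  by rewrite cards1 muln0 big1 // => v _; apply: eq_card0 => y; rewrite inE.
have [t [A [[ts te tr tA [cA sA]] rA]]] := IH (ltnW kT).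
have [a [b [aA bA eab]]] : exists a b, [/\ a \in A, b \notin A & e a b].
  have [z zA] : exists z, z \notin A.
    apply/existsP; rewrite -negb_forall; apply: contraTN kT => /forallP all_A.
    rewrite -leqNgt -cA; apply/subset_leq_card/subsetP=> x _; exact: all_A.
  have step p x : x \in A -> path e x p -> last x p \notin A ->
      exists a b, [/\ a \in A, b \notin A & e a b].
    elim: p x => [|y p IHp] x xA /=; first by rewrite xA.
    case/andP=> exy pp lp; have [yA|yA] := boolP (y \in A); first exact: IHp pp lp.
    by exists x, y.
  by have /connectP[p pp E] := ec r z; apply: step rA pp _; rewrite -E.
have ab : a != b by apply: contraNneq bA => <-.
have tab : ~~ t a b by apply: contraNN bA; rewrite ts; apply: tA.
have sub : subrel t (add_edge t a b) by move=> x y h; rewrite /add_edge /= h.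
have tr' x : x \in A -> connect (add_edge t a b) r x.
  move/tr; apply: connect_sub => y z /sub; apply: connect1.
exists (add_edge t a b), (b |: A); split; last by rewrite in_setU1 rA orbT.
split.
- exact: add_edge_sym.
- move=> x y /orP[/te //|/orP[]/andP[/eqP-> /eqP->] //].
  by rewrite es.
- move=> x; rewrite in_setU1 => /orP[/eqP->|]; last exact: tr'.
  apply: connect_trans (tr' _ aA) _; apply: connect1.
  by rewrite /add_edge /edge_of /= !eqxx orbT.
- move=> x y /orP[/tA|/orP[]/andP[/eqP-> _]]; rewrite in_setU1 ?eqxx //.
    by move=> ->; rewrite orbT.
  by rewrite aA orbT.
by rewrite cardsU1 bA cA sum_deg_add_edge // sA; split; lia.
Qed.

Lemma spanning_tree_exists e : symmetric e -> connected_graph e ->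
  exists t, spanning_tree e t.
Proof.
move=> es ec; have [r _|T0] := pickP T; last first.
  (* On the empty type [e] itself serves, because [#|T| - 1] truncates to zero. *)
  exists e; split=> //; have cT : #|T| = 0 by apply: eq_card0 => x; have := T0 x.
  by rewrite cT eq_card0 // => x; have := T0 x.1.
have T0 : 0 < #|T| by apply/card_gt0P; exists r.
have kT : #|T|.-1 < #|T| by rewrite prednK.
have [t [A [[ts te tr tA [cA sA]] rA]]] := partial_spanning_tree r es ec kT.
have allA x : x \in A.
  have /eqP -> : A == setT by rewrite eqEcard subsetT cardsT cA prednK /=.
  by rewrite inE.
exists t; split=> //; last by rewrite card_darts sA subn1.
move=> x y; apply: connect_trans (tr y (allA y)).
by rewrite (sym_connect_sym ts); apply: tr.
Qed.

(** Sets of pairs form a finite type, over which [arg_minnP] can minimise the number of leaves. *)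
Definition rel_of (S : {set T * T}) : rel T := [rel x y | (x, y) \in S].

Lemma rel_ofK t : rel_of [set p | t p.1 p.2] =2 t.
Proof. by move=> x y; rewrite /rel_of /= inE. Qed.

Lemma eq_spanning_tree e t t' : t =2 t' -> spanning_tree e t -> spanning_tree e t'.
Proof.
move=> E [ts te tc tn]; split.
- by move=> x y; rewrite -!E.
- by move=> x y; rewrite -E; apply: te.
- by move=> x y; rewrite -(eq_connect E).
by rewrite -tn; apply: eq_card => p; rewrite !inE E.
Qed.

Definition spanning_treeb e t :=
  [&& [forall x, forall y, t x y == t y x], [forall x, forall y, t x y ==> e x y],
      [forall x, forall y, connect t x y] &
      #|[set p : T * T | t p.1 p.2]| == 2 * (#|T| - 1)].

Lemma spanning_treeP e t : reflect (spanning_tree e t) (spanning_treeb e t).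
Proof.
apply: (iffP and4P) => [[/forallP ts /forallP te /forallP tc /eqP tn]|[ts te tc tn]].
  split=> // [x y|x y|x y]; first exact/eqP/(forallP (ts x)).
    exact/implyP/(forallP (te x)).
  exact/(forallP (tc x)).
split; last exact/eqP.
- by apply/forallP=> x; apply/forallP=> y; apply/eqP.
- by apply/forallP=> x; apply/forallP=> y; apply/implyP/te.
by apply/forallP=> x; apply/forallP=> y.
Qed.

Lemma fewest_leaves_exists e : symmetric e -> connected_graph e ->
  exists2 t, spanning_tree e t &
    forall t', spanning_tree e t' -> #|leaves t| <= #|leaves t'|.
Proof.
move=> es ec; have [t0 tree0] := spanning_tree_exists es ec.
have of_tree t : spanning_tree e t -> spanning_tree e (rel_of [set p | t p.1 p.2]).
  by apply: eq_spanning_tree => x y; rewrite rel_ofK.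
have /spanning_treeP tree0' := of_tree _ tree0.
case: (arg_minnP (P := fun S => spanning_treeb e (rel_of S))
         (fun S => #|leaves (rel_of S)|) tree0') => S /spanning_treeP treeS minS.
exists (rel_of S) => // t tree.
have := minS _ (introT (spanning_treeP e _) (of_tree _ tree)).
suff -> : leaves (rel_of [set p | t p.1 p.2]) = leaves t by [].
by apply/setP=> v; rewrite !inE (eq_deg v (rel_ofK t)).
Qed.

(** Handshake count: at each vertex, two plus the branch indicator is at most the degree plus the
    leaf indicator. *)
Lemma branches_lt_leaves t : \sum_v deg t v = 2 * (#|T| - 1) ->
  (forall v, 0 < deg t v) -> 0 < #|T| -> #|branches t| + 2 <= #|leaves t|.
Proof.
move=> st t0 T0.
have : \sum_v (2 + (2 < deg t v : nat)) <= \sum_v (deg t v + (deg t v == 1 : nat)).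
  by apply: leq_sum => v _; have := t0 v; deg_lia.
rewrite !big_split /= st sum_nat_const -!card_sum_bool -/(leaves t) -/(branches t).
have -> : #|xpredT : pred T| = #|T| by apply: eq_card.
by move: T0; clear; lia.
Qed.

End MainTheorem.

Theorem mainTheorem1 (T : finType) (e : rel T) (k m : nat) :
  simple_graph e -> connected_graph e -> K14_free e ->
  m <= k + 1 ->
  sigma_ge e (m + 2) (#|T| - k) ->
  exists t : rel T, spanning_tree e t /\
    #|leaves t| + #|branches t| <= m + k + 2.
Proof.
move=> [es ei] ec k14 mk sigma.
have [t tree tmin] := fewest_leaves_exists es ec.
exists t; split=> //; have st := tree_sum_deg tree.
have [T1|T2] := leqP #|T| 1.
  have t0 v : deg t v = 0.
    have : deg t v <= \sum_u deg t u by rewrite (bigD1 v) //= leq_addr.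
    by rewrite st; move: T1; deg_lia.
  have -> : leaves t = set0 by apply/setP=> v; rewrite !inE t0.
  have -> : branches t = set0 by apply/setP=> v; rewrite !inE t0.
  by rewrite cards0.
have tpos v : 0 < deg t v.
  have [x xv] : exists x, x != v.
    have : 0 < #|[set~ v]| by rewrite cardsC1; lia.
    by case/card_gt0P=> x; rewrite !inE; exists x.
  exact: (tree_deg_gt0 tree xv).
have bl := branches_lt_leaves st tpos (ltnW T2).
have [l2|l3] := leqP #|leaves t| 2; first by move: bl l2; clear; lia.
have fl : fewest_leaves e t by split.
have bound := leaf_degrees_bound es ei k14 fl.
rewrite leqNgt; apply/negP=> big.
pose S := [set:: take (m + 2) (enum (leaves t))].
have uS : uniq (take (m + 2) (enum (leaves t))) by apply/take_uniq/enum_uniq.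
have cS : #|S| = m + 2.
  rewrite cardsE (card_uniqP uS) size_takel // -cardE.
  (* Enough leaves exist: twice their number is at least [m + k + 5], hence at least [2 * m + 4] by
     [m <= k + 1]. *)
  by move: bl big mk; clear; lia.
have SL : S \subset leaves t.
  by apply/subsetP=> v; rewrite inE => /mem_take; rewrite mem_enum.
have dS x : x \in S -> deg t x = 1.
  by move/(subsetP SL); rewrite inE => /eqP.
have := sigma S _ cS.
have iS : independent e S.
  by move=> x y xS yS; apply: (leaves_nonadjacent es ei fl) (dS _ xS) (dS _ yS).
move/(_ iS).
(* Each leaf outside [S] contributes at least one to the degree sum, so the sum over [S] is at most
   [#|T|] minus the branch vertices and the remaining leaves, which falls below [#|T| - k]. *)
have rest : #|leaves t :\: S| <= \sum_(y in leaves t :\: S) deg e y.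
  rewrite -sum1_card; apply: leq_sum => v _; apply: leq_trans (tpos v) _.
  apply: subset_leq_card; apply/subsetP=> y; rewrite !inE.
  by have [_ te _ _] := tree; apply: te.
have := cardsID S (leaves t); rewrite (setIidPr SL) cS.
move: bound; rewrite (big_setID S) /= (setIidPr SL).
move: rest big; clear; lia.
Qed.
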